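(* Fix a bandwidth-sharing network structure $(\mathbf A,\mathbf C,\boldsymbol\kappa)$ and $\alpha\ge 1$, and consider the flow-vector Markov process $\mathbf N(\cdot)$ under the $\alpha$-fair policy with traffic parameters $(\boldsymbol\mu,\boldsymbol\nu)$ such that $\mathbf A\boldsymbol\rho<\mathbf C$ componentwise. Suppose $\mathbf N(0)=\mathbf 0$. For $T\geq 0$ let $N^*(T)=\sup_{t\in[0,T],\,i\in\mathcal I}N_i(t)$, and let $\varepsilon=\varepsilon(\boldsymbol\rho)$ be the gap. Then there is a positive load-dependent constant $K$ such that for any $b>0$ (and any $T$), $$\mathbb P\big(N^*(T)\ge b\big)\le \frac{K\,T}{\varepsilon^{\alpha-1}\,b^{\alpha+1}} .$$
   Context: Network. $\mathcal J$ is a finite set of resources and $\mathcal I$ a finite set of routes, each route being identified with a nonempty subset of $\mathcal J$. $\mathbf A$ is the $|\mathcal J|\times|\mathcal I|$ matrix with $A_{ji}=1$ if route $i$ uses resource $j$ and $A_{ji}=0$ otherwise; it has rank $|\mathcal J|$. $\mathbf C=(C_j)_{j\in\mathcal J}$ has positive entries (capacities), $\boldsymbol\kappa=(\kappa_i)_{i\in\mathcal I}$ has positive entries (weights), $\alpha>0$. Traffic parameters: $\nu_i>0$ (arrival rates), $\mu_i>0$ (service rates), $\rho_i=\nu_i/\mu_i$. $\alpha$-fair policy. For $\mathbf n\in\mathbb R_+^{|\mathcal I|}$ let $\mathcal I_+(\mathbf n)=\{i:n_i>0\}$. Set $\Lambda_i(\mathbf n)=0$ for $i\notin\mathcal I_+(\mathbf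 n)$; if $\mathbf n\neq\mathbf 0$, $(\Lambda_i(\mathbf n))_{i\in\mathcal I_+(\mathbf n)}$ is the unique maximizer, over nonnegative vectors $(\Lambda_i)_{i\in\mathcal I_+(\mathbf n)}$ with $\sum_{i\in\mathcal I_+(\mathbf n)}A_{ji}\Lambda_i\le C_j$ for all $j\in\mathcal J$, of $\sum_{i\in\mathcal I_+(\mathbf n)}\kappa_i n_i^\alpha\frac{\Lambda_i^{1-\alpha}}{1-\alpha}$ if $\alpha\ne1$, and of $\sum_{i\in\mathcal I_+(\mathbf n)}\kappa_i n_i\log\Lambda_i$ if $\alpha=1$. Flow process. $\mathbf N(t)=(N_i(t))_{i\in\mathcal I}$ is the continuous-time Markov process on $\mathbb Z_+^{|\mathcal I|}$ with transition rates $\mathbf n\to\mathbf n+\mathbf e_i$ at rate $\nu_i$, $\mathbf n\to\mathbf n-\mathbf e_i$ at rate $\mu_i\Lambda_i(\mathbf n)$ if $n_i\ge1$, and no other transitions ($\mathbf e_i$ is the $i$th unit vector). Gap. If $\mathbf A\boldsymbol\rho<\mathbf C$ componentwise, $\varepsilon(\boldsymbol\rho)=\sup\{\tilde\varepsilon>0:(1+\tilde\varepsilon)\mathbf A\boldsymbol\rho\le\mathbf C\}$. Load-dependent constant. With $(\mathbf A,\mathbf C,\boldsymbol\kappa,\alpha)$ fixed, a positive load-dependent constant is a quantity of the form $K=f(\boldsymbol\mu,\boldsymbol\nu)$, where $f:(0,\infty)^{|\mathcal I|}\times(0,\infty)^{|\mathcal I|}\to(0,\infty)$ is a continuous function determined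 by $(\mathbf A,\mathbf C,\boldsymbol\kappa,\alpha)$ only. *)

(* Defs.v *)
From HB Require Import structures.
From mathcomp Require Export all_boot all_order all_algebra.
From mathcomp Require Export all_classical all_reals all_analysis.

Set Implicit Arguments.
Unset Strict Implicit.
Unset Printing Implicit Defensive.

Import Order.TTheory GRing.Theory Num.Theory.
Import numFieldNormedType.Exports.

Local Open Scope classical_set_scope.
Local Open Scope ring_scope.

(** Resources are indexed by ['I_J], routes by ['I_I]. *)

Definition incidence (R : realType) (J I : nat) (route : 'I_I -> {set 'I_J}) :
    'M[R]_(J, I) :=
  \matrix_(j, i) (j \in route i)%:R.

Definition positive_vec (R : realType) (m : nat) (x : 'cV[R]_m) : Prop :=
  forall i, 0 < x i 0.

Definition traffic_intensity (R : realType) (I : nat) (mu nu : 'cV[R]_I) :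
    'cV[R]_I :=
  \col_i (nu i 0 / mu i 0).

(** A real supremum, so it means what it should only if the set is bounded, i.e.
    if some [(A *m rho) j 0] is positive.  This holds as soon as there is a
    resource and [A] has full row rank; with no resource there is no route
    either. *)
Definition gap (R : realType) (J I : nat) (A : 'M[R]_(J, I)) (C : 'cV[R]_J)
    (rho : 'cV[R]_I) : R :=
  sup [set e : R | 0 < e /\ forall j, (1 + e) * (A *m rho) j 0 <= C j 0].

(** ** The alpha-fair policy *)

(** At [x = 0] the utility is [-oo] as soon as [alpha >= 1]; since [powR] and
    [ln] are total real functions, this has to be said explicitly. *)
Definition fair_utility (R : realType) (alpha x : R) : \bar R :=
  if alpha == 1 then lne x%:E
  else if (x == 0) && (1 < alpha) then -oo%E
  else (x `^ (1 - alpha) / (1 - alpha))%:E.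

(** For [alpha = 1] the weight [n_i `^ alpha] is [n_i]. *)
Definition fair_objective (R : realType) (I : nat) (kappa : 'cV[R]_I)
    (alpha : R) (n L : 'cV[R]_I) : \bar R :=
  (\sum_(i < I | (0 < n i 0)%R)
     (kappa i 0 * n i 0 `^ alpha)%R%:E * fair_utility alpha (L i 0)%R)%E.

Definition fair_feasible (R : realType) (J I : nat) (A : 'M[R]_(J, I))
    (C : 'cV[R]_J) (n L : 'cV[R]_I) : Prop :=
  (forall i, 0 < n i 0 -> 0 <= L i 0) /\
  (forall j, \sum_(i < I | 0 < n i 0) A j i * L i 0 <= C j 0).

(** [L] is the vector of bandwidths given to the routes in flow state [n].  The
    objective being strictly concave in the coordinates with [n_i > 0], there is
    only one such [L]. *)
Definition is_fair_allocation (R : realType) (J I : nat) (A : 'M[R]_(J, I))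
    (C : 'cV[R]_J) (kappa : 'cV[R]_I) (alpha : R) (n L : 'cV[R]_I) : Prop :=
  (forall i, ~~ (0 < n i 0) -> L i 0 = 0) /\
  (n != 0 ->
     fair_feasible A C n L /\
     forall L', fair_feasible A C n L' ->
       (fair_objective kappa alpha n L' <= fair_objective kappa alpha n L)%E).

Definition is_fair_policy (R : realType) (J I : nat) (A : 'M[R]_(J, I))
    (C : 'cV[R]_J) (kappa : 'cV[R]_I) (alpha : R)
    (Lambda : 'cV[R]_I -> 'cV[R]_I) : Prop :=
  forall n : 'cV[R]_I, (forall i, 0 <= n i 0) ->
    is_fair_allocation A C kappa alpha n (Lambda n).

(** ** Continuous-time Markov processes on a countable state space *)

Definition is_transition_function (R : realType) (S : countType)
    (p : R -> S -> S -> R) : Prop :=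
  [/\ forall t n m, 0 <= t -> 0 <= p t n m,
      forall t n, 0 <= t -> \esum_(m in [set: S]) (p t n m)%:E = 1%E,
      forall n m, p 0 n m = (n == m)%:R &
      forall s t n m, 0 <= s -> 0 <= t ->
        (p (s + t) n m)%:E = \esum_(k in [set: S]) (p s n k * p t k m)%:E].

(** [q n m] is the rate of the transition [n -> m] for [m != n]; its diagonal is
    not used, the total rate out of [n] being the sum of the [q n m], [m != n].
    When these sums are bounded, as in the flow process below, the rates
    determine the transition function. *)
Definition has_transition_rates (R : realType) (S : countType)
    (p : R -> S -> S -> R) (q : S -> S -> R) : Prop :=
  (forall n m, n != m -> p h n m / h @[h --> 0^'+] --> q n m) /\
  (forall n, ((1 - p h n n) / h)%:E @[h --> 0^'+] -->
     \esum_(m in [set m | m != n]) (q n m)%:E).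

(** Only times [t >= 0] matter.  [hist] lists finitely many constraints
    [X u = x] on the past of [s], so the last clause says that, given
    [X s = n], the past is independent of [X (s + h)], whose law is
    [p h n]. *)
Definition is_markov_process (R : realType) (d : measure_display)
    (Om : measurableType d) (P : probability Om R) (S : countType)
    (q : S -> S -> R) (X : R -> Om -> S) : Prop :=
  [/\ forall t n, 0 <= t -> measurable [set w | X t w = n],
      forall w t, 0 <= t -> \forall s \near t^'+, X s w = X t w &
      exists p : R -> S -> S -> R,
        [/\ is_transition_function p, has_transition_rates p q &
          forall (s h : R) (hist : seq (R * S)) (n m : S),
            0 <= s -> 0 <= h ->
            (forall c, c \in hist -> 0 <= c.1 <= s) ->
            let past := [set w | (forall c, c \in hist -> X c.1 w = c.2) /\
                                 X s w = n] in
            P (past `&` [set w | X (s + h) w = m]) =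
              (P past * (p h n m)%:E)%E]].

(** ** The flow process *)

Definition unit_vec (I : nat) (i : 'I_I) : 'cV[nat]_I := delta_mx i 0.

Definition real_vec (R : realType) (I : nat) (n : 'cV[nat]_I) : 'cV[R]_I :=
  map_mx (fun k : nat => k%:R) n.

(** [n == m + unit_vec i] says that [n i 0 >= 1] and that [m] is [n] minus the
    [i]th unit vector.  For given [n != m] at most one summand is nonzero. *)
Definition flow_rates (R : realType) (I : nat) (mu nu : 'cV[R]_I)
    (Lambda : 'cV[R]_I -> 'cV[R]_I) (n m : 'cV[nat]_I) : R :=
  \sum_(i < I)
    ((m == n + unit_vec i)%:R * nu i 0 +
     (n == m + unit_vec i)%:R * (mu i 0 * Lambda (real_vec R n) i 0)).

Definition running_max (R : realType) (Om : Type) (I : nat)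
    (N : R -> Om -> 'cV[nat]_I) (T : R) (w : Om) : \bar R :=
  ereal_sup [set x | exists (t : R) (i : 'I_I),
                       0 <= t <= T /\ x = ((N t w i 0)%:R : R)%:E].

(** ** Load-dependent constants *)

Definition load_domain (R : realType) (I : nat) : set ('cV[R]_I * 'cV[R]_I) :=
  [set x | positive_vec x.1 /\ positive_vec x.2].

Definition is_load_function (R : realType) (I : nat)
    (f : 'cV[R]_I * 'cV[R]_I -> R) : Prop :=
  (forall x, load_domain x -> 0 < f x) /\
  {within @load_domain R I, continuous f}.

(* Main.v *)
(** With [c_i = kappa_i * rho_i `^ (- alpha) / mu_i], the Lyapunov function
    [F n = \sum_i c_i * n_i `^ (alpha + 1) / (alpha + 1)] has fluid drift
    [\sum_i kappa_i * n_i `^ alpha * rho_i `^ (- alpha) * (rho_i - Lambda_i)],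
    which is at most [- e * \sum_i kappa_i * n_i `^ alpha * rho_i `^ (1 - alpha)]
    for the gap [e], by first-order optimality of the allocation compared with
    the feasible point [(1 + e) * rho].  The second-order part of the jumps is of
    order [n `^ (alpha - 1)], so the drift of [F] is bounded above by a
    load-dependent constant over [e `^ (alpha - 1)], and a maximal inequality
    gives the tail of the running maximum.

    The maximal inequality is proved for the bounded function
    [H = Num.max 0 (1 - F / B)].  Up to its drift, [H] bounds from below the
    probability of not reaching level [B] at the points of a dyadic time grid, by
    induction on their number, and right continuity of the paths makes dyadic times
    sufficient.  Only a lower bound for the conditional expectation of [H] is
    needed, so finitely many transitions matter at each step; for those the rates
    give [p t n m >= t * q n m * (1 - Q * t)] uniformly in [n], where [Q] bounds the
    exit rates. *)

Require Import Defs.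
From mathcomp Require Import ring lra.

Set Implicit Arguments.
Unset Strict Implicit.
Unset Printing Implicit Defensive.

Import Order.TTheory GRing.Theory Num.Theory.
Import numFieldNormedType.Exports.

Local Open Scope classical_set_scope.
Local Open Scope ring_scope.

(** * Transition functions with bounded rates *)

Lemma cvgr_ge_nat (R : realType) (u : nat -> R) (l c : R) :
  u @ \oo --> l -> (forall k, c <= u k) -> c <= l.
Proof.
move=> ul cu; rewrite -(cvg_lim (@Rhausdorff R) ul); apply: limr_ge.
  by apply/cvg_ex; exists l.
by near=> k.
Unshelve. all: by end_near. Qed.

(** The limit is taken along [h = t / k.+1]. This turns an estimate over [k.+1] equal steps that
    fill an interval of length [t] into one on the rate at [0]. *)
Lemma at_right_divn_ge (R : realType) (g : R -> R) (t l c : R) :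
  0 < t -> g h / h @[h --> 0^'+] --> l ->
  (forall k, c <= k.+1%:R * g (t / k.+1%:R)) -> c <= t * l.
Proof.
move=> t0 /cvg_at_rightP gl cg.
have /gl ul : (forall n, 0 < t / n.+1%:R) /\ t / n.+1%:R @[n --> \oo] --> 0.
  split=> [n|]; first by rewrite divr_gt0.
  by rewrite -(mulr0 t); apply: cvgM; [exact: cvg_cst|exact: cvg_harmonic].
apply: (@cvgr_ge_nat R _ _ _ (cvgM (cvg_cst t) ul)) => k.
suff e : t * (g (t / k.+1%:R) / (t / k.+1%:R)) = k.+1%:R * g (t / k.+1%:R).
  by apply: le_trans (cg k) _; rewrite -e.
by rewrite mulrCA invf_div [t * (_ / _)]mulrC divfK ?gt_eqF// mulrC.
Qed.

Lemma esum_ge_seq (R : realType) (T : choiceType) (a : T -> R) (r : seq T) :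
  uniq r -> ((\sum_(i <- r) a i)%:E <= \esum_(i in [set: T]) (a i)%:E)%E.
Proof.
move=> ur; apply: esum_ge; exists [set` r].
  by split.
by rewrite -fsbig_seq// sumEFin.
Qed.

Section TransitionFunction.
Context (R : realType) (S : countType) (p : R -> S -> S -> R) (q : S -> S -> R).
Hypothesis tr_p : is_transition_function p.

Lemma transition_ge0 t n m : 0 <= t -> 0 <= p t n m.
Proof. by case: tr_p => + _ _ _; exact. Qed.

Lemma transition_sum_le1 t n (r : seq S) :
  0 <= t -> uniq r -> \sum_(m <- r) p t n m <= 1.
Proof.
move=> t0 ur; case: tr_p => _ + _ _ => /(_ t n t0) p1.
by rewrite -lee_fin -p1; exact: esum_ge_seq.
Qed.

Lemma transition_ge_seq s t n m (r : seq S) : 0 <= s -> 0 <= t -> uniq r ->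
  \sum_(k <- r) p s n k * p t k m <= p (s + t) n m.
Proof.
move=> s0 t0 ur; case: tr_p => _ _ _ /(_ s t n m s0 t0) pst.
by rewrite -lee_fin pst; exact: esum_ge_seq.
Qed.

Lemma transition_ge1 s t n k m : 0 <= s -> 0 <= t ->
  p s n k * p t k m <= p (s + t) n m.
Proof.
by move=> s0 t0; have := @transition_ge_seq s t n m [:: k] s0 t0 isT; rewrite big_seq1.
Qed.

Lemma transition_diag_le1 t n : 0 <= t -> p t n n <= 1.
Proof.
by move=> t0; have := @transition_sum_le1 t n [:: n] t0 isT; rewrite big_seq1.
Qed.

Lemma transition0 n m : p 0 n m = (n == m)%:R.
Proof. by case: tr_p => _ _ + _; exact. Qed.

Context (nb : S -> seq S) (Q : R).
Hypotheses (q_p : has_transition_rates p q) (q_ge0 : forall n m, 0 <= q n m)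
  (nb_uniq : forall n, uniq (nb n)) (nb_irr : forall n, n \notin nb n)
  (q_nb : forall n m, m != n -> m \notin nb n -> q n m = 0)
  (q_le : forall n, \sum_(m <- nb n) q n m <= Q).

Lemma exit_rateE n :
  \esum_(m in [set m | m != n]) (q n m)%:E = (\sum_(m <- nb n) q n m)%:E.
Proof.
rewrite -sumEFin fsbig_seq// -esum_fset//; last by move=> m _; rewrite lee_fin.
rewrite esum_mkcond [RHS]esum_mkcond; apply: eq_esum => m _.
have [mnb|mnb] := boolP (m \in nb n).
  have mn : m != n by apply: contraTneq mnb => ->; exact: nb_irr.
  by rewrite !ifT//; exact: mem_set.
rewrite [in RHS]ifF; last exact/memNset/negP.
by case: ifPn => // /set_mem/= mn; rewrite q_nb.
Qed.

(* [1 - p t n n] is subadditive in [t]. *)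
Lemma transition_diag_ge t n : 0 <= t -> 1 - t * \sum_(m <- nb n) q n m <= p t n n.
Proof.
rewrite le_eqVlt => /predU1P[<-|t0]; first by rewrite mul0r subr0 transition0 eqxx.
have sub h k : 0 <= h -> 1 - p (k%:R * h) n n <= k%:R * (1 - p h n n).
  move=> h0; elim: k => [|k ih]; first by rewrite !mul0r transition0 eqxx subrr.
  have kh0 : 0 <= k%:R * h by rewrite mulr_ge0.
  have := @transition_ge1 _ _ n n n kh0 h0.
  have := transition_diag_le1 n h0; have := transition_diag_le1 n kh0.
  have := transition_ge0 n n h0; have := transition_ge0 n n kh0.
  rewrite -natr1 [(_ + 1) * h]mulrDl mul1r.
  set x := p _ n n in ih *; set y := p h _ _ in ih *; set z := p _ n n.
  by nra.
have cv : (1 - p h n n) / h @[h --> 0^'+] --> \sum_(m <- nb n) q n m.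
  by case: q_p => _ /(_ n); rewrite exit_rateE => /fine_cvgP[].
have := at_right_divn_ge t0 cv (c := 1 - p t n n).
rewrite lerBlDr -lerBlDl; apply => k.
have := sub (t / k.+1%:R) k.+1 (divr_ge0 (ltW t0) (ler0n _ _)).
by rewrite mulrC divfK ?pnatr_eq0.
Qed.

Lemma exit_rate_ge0 n : 0 <= \sum_(m <- nb n) q n m.
Proof. exact: sumr_ge0. Qed.

Lemma transition_diag_geQ t n : 0 <= t -> 1 - Q * t <= p t n n.
Proof.
move=> t0; apply: le_trans (transition_diag_ge n t0).
by rewrite lerD2l lerN2 mulrC ler_wpM2r.
Qed.

(* A path which makes the jump [n -> m] in one of the [k] intervals of length [h]
   and stays put in the others has probability at least
   [p h n m * (1 - Q * (k * h))]. *)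
Lemma transition_ge_mul h n m k : 0 <= h -> n != m -> Q * (k%:R * h) <= 1 ->
  k%:R * p h n m * (1 - Q * (k%:R * h)) <= p (k%:R * h) n m.
Proof.
move=> h0 nm; elim: k => [|k ih] kh1.
  by rewrite !mul0r transition0 (negbTE nm).
have kh0 : 0 <= k%:R * h by rewrite mulr_ge0.
have Q0 : 0 <= Q by exact: le_trans (exit_rate_ge0 n) (q_le n).
rewrite -natr1 in kh1 *; rewrite [(_ + 1) * h]mulrDl mul1r in kh1 *.
have kh1' : Q * (k%:R * h) <= 1 by rewrite mulrDr in kh1; have := mulr_ge0 Q0 h0; lra.
have {}ih := ih kh1'.
have ur : uniq [:: n; m] by rewrite /= inE nm.
(* Before the last interval the state is either [n], with the jump still to come, or [m], which must
   then be kept. *)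
have := @transition_ge_seq _ _ n m _ kh0 h0 ur.
rewrite big_cons big_seq1.
have := transition_ge0 n m h0; have := transition_diag_geQ n kh0.
have := transition_diag_geQ m h0.
have : 0 <= k%:R :> R by [].
set x := p _ n n; set y := p h n m in ih *; set z := p _ n m in ih *; set w := p h m m.
move=> k0 w1 x1 y0 le1; apply: le_trans le1.
have : (1 - Q * (k%:R * h)) * y <= x * y by rewrite ler_wpM2r.
have : k%:R * y * (1 - Q * (k%:R * h)) * (1 - Q * h) <= z * w.
  have Qh1 : Q * h <= 1 by rewrite mulrDr in kh1; have := mulr_ge0 Q0 kh0; lra.
  by apply: ler_pM => //; rewrite ?mulr_ge0// subr_ge0.
have : 0 <= k%:R * y * ((Q * (k%:R * h)) * (Q * h)) by rewrite !mulr_ge0.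
have : 0 <= y * (Q * h) by rewrite !mulr_ge0.
by lra.
Qed.

(** Let [k] grow in [transition_ge_mul] with [h = t / k]: then [k * p h n m] tends to [t * q n m].
    When [Q * t > 1] the left-hand side is nonpositive. *)
Lemma transition_ge_rate t n m : 0 <= t -> n != m ->
  t * q n m * (1 - Q * t) <= p t n m.
Proof.
move=> t0 nm; have [Qt1|Qt1] := lerP (Q * t) 1; last first.
  apply: le_trans (transition_ge0 n m t0).
  by rewrite mulr_ge0_le0 ?mulr_ge0// subr_le0 ltW.
move: t0; rewrite le_eqVlt => /predU1P[<-|t0]; first by rewrite !mul0r transition0 ler0n.
(* Signs are reversed because [at_right_divn_ge] bounds a limit from below. *)
have cv : - (p h n m * (1 - Q * t)) / h @[h --> 0^'+] --> - (q n m * (1 - Q * t)).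
  case: q_p => /(_ n m nm) qp _.
  under eq_fun do rewrite mulNr mulrAC.
  by apply: cvgN; apply: cvgM => //; exact: cvg_cst.
have := at_right_divn_ge t0 cv (c := - p t n m).
rewrite mulrN lerN2 mulrA; apply => k.
have := @transition_ge_mul (t / k.+1%:R) n m k.+1 (divr_ge0 (ltW t0) (ler0n _ _)) nm.
rewrite [k.+1%:R * (_ / _)]mulrC divfK ?pnatr_eq0// => /(_ Qt1).
by rewrite mulrN lerN2 mulrA.
Qed.

(** The first-order part is the drift. The factor [1 - Q * t] in the jump probabilities costs at
    most [Q * t ^+ 2] times the sum of the [q n m * H m], and that sum is at most [Q] because
    [H <= 1]. *)
Lemma transition_drift (H : S -> R) (K t : R) n : 0 <= t ->
  (forall m, 0 <= H m <= 1) ->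
  - K <= \sum_(m <- nb n) q n m * (H m - H n) ->
  H n - (K * t + (Q * t) ^+ 2) <= \sum_(m <- n :: nb n) p t n m * H m.
Proof.
move=> t0 H01 HK; rewrite big_cons.
have Q0 : 0 <= Q by exact: le_trans (exit_rate_ge0 n) (q_le n).
set s := \sum_(m <- nb n) q n m.
have [Hn0 Hn1] := andP (H01 n).
have diag : (1 - t * s) * H n <= p t n n * H n.
  by rewrite ler_wpM2r//; exact: transition_diag_ge.
set V := \sum_(m <- nb n) q n m * H m.
have V0 : 0 <= V by apply: sumr_ge0 => m _; rewrite mulr_ge0//; case/andP: (H01 m).
have VQ : V <= Q.
  apply: le_trans (q_le n); apply: ler_sum => m _.
  by rewrite ler_piMr//; case/andP: (H01 m).
have off : t * (1 - Q * t) * V <= \sum_(m <- nb n) p t n m * H m.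
  rewrite mulr_sumr big_seq [leRHS]big_seq; apply: ler_sum => m mnb.
  have nm : n != m by apply: contraTneq mnb => <-; exact: nb_irr.
  have [Hm0 _] := andP (H01 m).
  by rewrite mulrA ler_wpM2r// mulrAC; exact: transition_ge_rate.
have drift : \sum_(m <- nb n) q n m * (H m - H n) = V - s * H n.
  by rewrite /V /s mulr_suml -sumrB; apply: eq_bigr => m _; rewrite mulrBr.
rewrite drift in HK.
have e1 : t * (- K) <= t * (V - s * H n) by rewrite ler_wpM2l.
have e2 : Q * t ^+ 2 * V <= Q * t ^+ 2 * Q by rewrite ler_wpM2l// mulr_ge0 ?sqr_ge0.
rewrite exprMn; nra.
Qed.

End TransitionFunction.

(** * Hitting probabilities *)

Section FineProbability.
Context (R : realType) (d : measure_display) (Om : measurableType d)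
  (P : probability Om R).

Lemma fine_probabilityK (E : set Om) : measurable E -> (fine (P E))%:E = P E.
Proof. by move=> mE; rewrite fineK// fin_num_measure. Qed.

Lemma fine_probability_le (E F : set Om) :
  measurable E -> measurable F -> E `<=` F -> fine (P E) <= fine (P F).
Proof.
move=> mE mF EF; rewrite -lee_fin !fine_probabilityK//.
by apply: le_measure; rewrite ?inE.
Qed.

Lemma fine_probability_sum_le (S : choiceType) (r : seq S) (E : S -> set Om)
    (F : set Om) :
  uniq r -> (forall m, measurable (E m)) -> trivIset [set: S] E ->
  measurable F -> (forall m, E m `<=` F) ->
  \sum_(m <- r) fine (P (E m)) <= fine (P F).
Proof.
move=> ur mE tE mF EF; rewrite -lee_fin fine_probabilityK// -sumEFin.
under eq_bigr do rewrite fine_probabilityK//.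
rewrite fsbig_seq// -measure_fin_bigcup//.
- apply: le_measure; rewrite ?inE//; last exact: bigcup_sub.
  exact: fin_bigcup_measurable.
- exact: sub_trivIset tE.
Qed.

End FineProbability.

Definition hitting_event (R : realType) (Om S : Type) (X : R -> Om -> S)
    (D : set S) (T : R) : set Om :=
  [set w | exists t, 0 <= t <= T /\ D (X t w)].

Section HittingProbability.
Context (R : realType) (d : measure_display) (Om : measurableType d)
  (P : probability Om R) (S : countType) (q : S -> S -> R)
  (X : R -> Om -> S).
Hypothesis markov_X : is_markov_process P q X.
Context (D : set S).

Definition past_event (hist : seq (R * S)) (s : R) (n : S) : set Om :=
  [set w | (forall c, c \in hist -> X c.1 w = c.2) /\ X s w = n].

Definition survival_event (s h : R) (M : nat) : set Om :=
  [set w | forall k, (k <= M)%N -> ~ D (X (s + k%:R * h) w)].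

Lemma measurable_past_event hist s n : 0 <= s ->
  (forall c, c \in hist -> 0 <= c.1) -> measurable (past_event hist s n).
Proof.
case: markov_X => mX _ _ s0 hist0.
suff mh : measurable [set w | forall c, c \in hist -> X c.1 w = c.2].
  by apply: measurableI => //; exact: mX.
elim: hist hist0 => [|c hist ih] hist0.
  by rewrite [X in measurable X](_ : _ = setT)//; apply/seteqP; split.
rewrite [X in measurable X](_ : _ = [set w | X c.1 w = c.2] `&`
                       [set w | forall c, c \in hist -> X c.1 w = c.2]).
  apply: measurableI; first by apply: mX; apply: hist0; rewrite mem_head.
  by apply: ih => c' c'h; apply: hist0; rewrite inE c'h orbT.
apply/seteqP; split => w /=.
  by move=> Xw; split => [|c' c'h]; apply: Xw; rewrite inE ?eqxx// c'h orbT.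
by move=> [Xc Xw] c'; rewrite inE => /predU1P[->|/Xw].
Qed.

Lemma measurable_state_event s (E : set S) : 0 <= s -> measurable [set w | E (X s w)].
Proof.
case: markov_X => mX _ _ s0.
rewrite [X in measurable X](_ : _ =
  \bigcup_m (if m \in E then [set w | X s w = m] else set0)).
  apply: countable_bigcupT_measurable => [|m]; first exact: countableP.
  case: ifP => _ //; exact: mX.
apply/seteqP; split => w /=.
  by move=> Ew; exists (X s w) => //; rewrite mem_set.
by move=> [m _]; case: ifPn => // /set_mem Em /= ->.
Qed.

Lemma measurable_survival_event s h M : 0 <= s -> 0 <= h ->
  measurable (survival_event s h M).
Proof.
move=> s0 h0.
rewrite (_ : survival_event s h M =
  \bigcap_(k in `I_M.+1) ~` [set w | D (X (s + k%:R * h) w)]).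
  apply: bigcap_measurable => [|k _]; first by exists 0%N.
  apply/measurableC/measurable_state_event.
  by rewrite addr_ge0// mulr_ge0.
by apply/seteqP; split => w Dw k; exact: Dw.
Qed.

Context (nb : S -> seq S) (Q K : R) (H : S -> R).
Hypotheses (q_ge0 : forall n m, 0 <= q n m)
  (nb_uniq : forall n, uniq (nb n)) (nb_irr : forall n, n \notin nb n)
  (q_nb : forall n m, m != n -> m \notin nb n -> q n m = 0)
  (q_le : forall n, \sum_(m <- nb n) q n m <= Q)
  (H01 : forall n, 0 <= H n <= 1) (H_D : forall n, D n -> H n = 0)
  (K_ge0 : 0 <= K)
  (H_drift : forall n, - K <= \sum_(m <- nb n) q n m * (H m - H n)).

(** Induction on [M] for all histories at once: after one step the pair [(s, n)] joins the history
    and the Markov property applies again. Each step costs the error of [transition_drift]. *)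
Lemma survival_ge (h : R) (M : nat) (hist : seq (R * S)) (s : R) (n : S) :
  0 <= h -> 0 <= s -> (forall c, c \in hist -> 0 <= c.1 <= s) ->
  fine (P (past_event hist s n)) * (H n - M%:R * (K * h + (Q * h) ^+ 2)) <=
  fine (P (past_event hist s n `&` survival_event s h M)).
Proof.
move=> h0; set delta := K * h + _.
have delta0 : 0 <= delta by rewrite addr_ge0 ?sqr_ge0// mulr_ge0.
elim: M hist s n => [|M ih] hist s n s0 hist0.
all: have mpast : measurable (past_event hist s n)
  by apply: measurable_past_event => // c /hist0/andP[].
all: have msurv k : measurable (survival_event s h k)
  by exact: measurable_survival_event.
all: have Ppast0 : 0 <= fine (P (past_event hist s n)) by exact: fine_ge0.
all: have [Dn|Dn] := pselect (D n); first
  by rewrite H_D// (le_trans _ (fine_ge0 _))// sub0r mulrN oppr_le0 !mulr_ge0.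
  rewrite mul0r subr0; apply: (@le_trans _ _ (fine (P (past_event hist s n)))).
    by rewrite ler_piMr//; case/andP: (H01 n).
  apply: fine_probability_le => //; first exact: measurableI.
  move=> w [past_w Xw]; split=> // k; rewrite leqn0 => /eqP ->.
  by rewrite mul0r addr0 Xw.
have [_ _ [p [tr_p q_p pX]]] := markov_X.
pose hist' := (s, n) :: hist.
have sh0 : 0 <= s + h by rewrite addr_ge0.
have hist'0 c : c \in hist' -> 0 <= c.1 <= s + h.
  rewrite inE => /predU1P[->/=|/hist0/andP[-> /= cs]]; first by rewrite s0 lerDl.
  by rewrite (le_trans cs)// lerDl.
have mpast' m : measurable (past_event hist' (s + h) m).
  by apply: measurable_past_event => // c /hist'0/andP[].
have msurv' : measurable (survival_event (s + h) h M).
  exact: measurable_survival_event.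
have past'E m : fine (P (past_event hist' (s + h) m)) =
    fine (P (past_event hist s n)) * p h n m.
  have : P (past_event hist s n `&` [set w | X (s + h) w = m]) =
      (P (past_event hist s n) * (p h n m)%:E)%E := pX s h hist n m s0 h0 hist0.
  rewrite -(fine_probabilityK P mpast) -EFinM => /(congr1 fine) /= <-.
  congr (fine (P _)); apply/seteqP; split => w [/=].
    move=> Xw Xm; split=> //; split; last exact: (Xw (s, n) (mem_head _ _)).
    by move=> c ch; apply: Xw; rewrite inE ch orbT.
  move=> [Xw Xs] Xm; split=> // c; rewrite inE => /predU1P[->//|]; exact: Xw.
(* The events for different next states are disjoint, and for a lower bound it is enough to keep [n]
   and its neighbors. *)
have surv_le : \sum_(m <- n :: nb n)
    fine (P (past_event hist' (s + h) m `&` survival_event (s + h) h M)) <=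
    fine (P (past_event hist s n `&` survival_event s h M.+1)).
  apply: fine_probability_sum_le => /=.
  - by rewrite nb_irr nb_uniq.
  - by move=> m; exact: measurableI.
  - by move=> m m' _ _ [w [[[_ <-] _] [[_ <-] _]]].
  - exact: measurableI.
  - move=> m w [[Xw _] surv_w].
    have Xs : X s w = n := Xw (s, n) (mem_head _ _).
    split; first by split=> // c ch; apply: Xw; rewrite inE ch orbT.
    case=> [_|k]; first by rewrite mul0r addr0 Xs.
    rewrite ltnS => /surv_w.
    suff -> : s + k.+1%:R * h = s + h + k%:R * h by [].
    by rewrite -natr1; ring.
apply: le_trans surv_le.
apply: (@le_trans _ _ (\sum_(m <- n :: nb n) fine (P (past_event hist s n)) *
    (p h n m * (H m - M%:R * delta)))); last first.
  apply: ler_sum => m _; rewrite mulrA -past'E; exact: ih.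
rewrite -mulr_sumr ler_wpM2l//.
under eq_bigr do rewrite mulrBr.
rewrite sumrB -mulr_suml.
have := transition_drift tr_p q_p q_ge0 nb_uniq nb_irr q_nb q_le h0 H01 (H_drift n).
(* The kept probabilities sum to at most [1], so the error of the later steps is not amplified. *)
have : \sum_(m <- n :: nb n) p h n m <= 1.
  by apply: (transition_sum_le1 tr_p) => //=; rewrite nb_irr nb_uniq.
have : 0 <= M%:R * delta by rewrite mulr_ge0.
rewrite -/delta -natr1.
set x := \sum_(m <- _) p h n m; set y := \sum_(m <- _) _; set z := M%:R * delta.
rewrite [(_ + 1) * _]mulrDl -/z.
by nra.
Qed.

Definition dyadic_hitting_event (T : R) (j : nat) : set Om :=
  ~` survival_event 0 (T / (2 ^ j)%:R) (2 ^ j).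

(** By right continuity a path in [D] at a time [t < T] stays there for a while, so a fine enough
    grid catches it. *)
Lemma hitting_event_dyadicE (T : R) : 0 <= T ->
  hitting_event X D T = \bigcup_j dyadic_hitting_event T j.
Proof.
have pow2_gt0 j : 0 < (2 ^ j)%:R :> R by rewrite ltr0n expn_gt0.
move=> T0; apply/seteqP; split => w.
  move=> [t [/andP[t0]]]; rewrite le_eqVlt => /predU1P[->|tT] Dt.
    (* Right continuity at [T] only concerns later times, but [T] itself is a grid point: [k = 1]
       for [j = 0]. *)
    exists 0%N => //= /(_ 1%N isT); apply; move: Dt.
    by rewrite add0r mul1r expn0 divr1.
  have [_ X_right _] := markov_X.
  have /nbhs_ballP[e /= e0 te] := X_right w t t0.
  have T_gt0 : 0 < T by exact: le_lt_trans tT.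
  have [j jT] : exists j, T / (2 ^ j)%:R < e.
    exists (Num.truncn (T / e)).+1; rewrite ltr_pdivrMr// -ltr_pdivrMl// mulrC.
    by apply: lt_le_trans (Num.Theory.truncnS_gt _) _; rewrite ler_nat ltnW// ltn_expl.
  set h := T / (2 ^ j)%:R in jT.
  have h_gt0 : 0 < h by rewrite divr_gt0.
  have /andP[kt tk] := Num.Theory.truncn_itv (divr_ge0 t0 (ltW h_gt0)).
  (* The first grid point strictly after [t], at distance at most [h < e]; strictly, because [t^'+]
     excludes [t]. *)
  set k := (Num.truncn (t / h)).+1 in tk.
  rewrite ltr_pdivrMr// in tk; rewrite ler_pdivlMr// in kt.
  have k2j : (k <= 2 ^ j)%N.
    rewrite -(ltr_nat R) -(ltr_pM2r h_gt0); apply: le_lt_trans kt _.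
    by rewrite mulrC divfK// gt_eqF.
  exists j => // surv; apply: (surv k k2j); rewrite add0r -/h te//=.
  rewrite /ball/= distrC ger0_norm ?subr_ge0 ?(ltW tk)//.
  apply: le_lt_trans jT; rewrite -natr1 mulrDl mul1r; lra.
move=> [j _ /existsNP[k]] /not_implyP[kj] /contrapT Dk.
exists (0 + k%:R * (T / (2 ^ j)%:R)); split=> //.
rewrite add0r mulr_ge0 ?divr_ge0// mulrCA ler_piMr// ler_pdivrMr// mul1r ler_nat//.
Qed.

(** Point [k] of one grid is point [2 * k] of the next. *)
Lemma dyadic_hitting_event_nondecreasing (T : R) :
  nondecreasing_seq (dyadic_hitting_event T).
Proof.
apply/nondecreasing_seqP => j; apply/subsetPset; apply: subsetC => w surv k kj.
have := surv (k * 2)%N; rewrite expnSr leq_mul2r kj orbT => /(_ isT).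
suff -> : (k * 2)%:R * (T / (2 ^ j * 2)%:R) = k%:R * (T / (2 ^ j)%:R) by [].
by rewrite !natrM; field; rewrite pnatr_eq0 -lt0n expn_gt0.
Qed.

(** Continuity from below along the grids: over [2 ^ j] steps the quadratic errors add up to
    [(Q * T) ^+ 2 / 2 ^ j], which vanishes in the limit. *)
Lemma hitting_probability_le (T : R) (x0 : S) : 0 <= T ->
  {ae P, forall w, X 0 w = x0} ->
  (P (hitting_event X D T) <= (1 - H x0 + K * T)%:E)%E.
Proof.
move=> T0 X0.
have h0 j : 0 <= T / (2 ^ j)%:R by rewrite divr_ge0.
have msurv j : measurable (survival_event 0 (T / (2 ^ j)%:R) (2 ^ j)).
  exact: measurable_survival_event.
have mdy j : measurable (dyadic_hitting_event T j).
  exact: measurableC.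
have mX0 : measurable (past_event [::] 0 x0) by exact: measurable_past_event.
have PX0 : P (past_event [::] 0 x0) = 1%E.
  have : P (~` past_event [::] 0 x0) = 0%E.
    apply/negligibleP; first exact: measurableC.
    by apply: negligibleS X0 => w /= nX Xw; apply: nX; split.
  rewrite probability_setC// -(fine_probabilityK P mX0) -EFinB => -[].
  by move=> /eqP; rewrite subr_eq0 => /eqP <-.
have dy_le j : fine (P (dyadic_hitting_event T j)) <=
    1 - H x0 + K * T + (Q * T) ^+ 2 * 2^-1 ^+ j.
  rewrite /dyadic_hitting_event probability_setC//.
  have := @survival_ge (T / (2 ^ j)%:R) (2 ^ j) [::] 0 x0 (h0 j) (lexx 0).
  rewrite PX0 mul1r => /(_ (fun c => ltac:(done))) surv_ge.
  have : fine (P (past_event [::] 0 x0 `&` survival_event 0 (T / (2 ^ j)%:R) (2 ^ j))) <=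
    fine (P (survival_event 0 (T / (2 ^ j)%:R) (2 ^ j))).
    by apply: fine_probability_le => //; exact: measurableI.
  move=> /(le_trans surv_ge).
  rewrite -(fine_probabilityK P (msurv j)) /=.
  set u := fine _.
  suff -> : (2 ^ j)%:R * (K * (T / (2 ^ j)%:R) + (Q * (T / (2 ^ j)%:R)) ^+ 2) =
    K * T + (Q * T) ^+ 2 * 2^-1 ^+ j by lra.
  by rewrite natrX exprVn; field; rewrite expf_neq0.
rewrite hitting_event_dyadicE//.
have mU : measurable (\bigcup_j dyadic_hitting_event T j) by exact: bigcupT_measurable.
have /fine_cvgP[_ cvP] : P (dyadic_hitting_event T j) @[j --> \oo] -->
    (fine (P (\bigcup_j dyadic_hitting_event T j)))%:E.
  rewrite fine_probabilityK//; apply: nondecreasing_cvg_mu => //.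
  exact: dyadic_hitting_event_nondecreasing.
rewrite -(fine_probabilityK P mU) lee_fin.
have half_lt1 : `|2^-1 : R| < 1 by rewrite ger0_norm// invf_lt1// ltr1n.
have cvU : 1 - H x0 + K * T + (Q * T) ^+ 2 * 2^-1 ^+ j -
    fine (P (dyadic_hitting_event T j)) @[j --> \oo] -->
    1 - H x0 + K * T + (Q * T) ^+ 2 * 0 - fine (P (\bigcup_j dyadic_hitting_event T j)).
  apply: cvgB cvP; apply: cvgD; first exact: cvg_cst.
  by apply: cvgM; [exact: cvg_cst|exact: cvg_expr].
have := cvgr_ge_nat (c := 0) cvU.
rewrite mulr0 addr0 subr_ge0; apply => j; rewrite subr_ge0; exact: dy_le.
Qed.

End HittingProbability.

(** * Power inequalities *)

Section PowerInequalities.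
Context (R : realType).
Implicit Types (a p x y r e c rho : R).

(** Young's inequality for [x] and the power [p - 1] of [y], with conjugate exponents [p] and
    [p / (p - 1)]. For [p = 1] both sides agree. *)
Lemma powR_tangent_le p x y : 1 <= p -> 0 <= x -> 0 <= y ->
  y `^ p + p * y `^ (p - 1) * (x - y) <= x `^ p.
Proof.
rewrite le_eqVlt => /predU1P[<-|p1] x0 y0.
  by rewrite subrr powRr0 !powRr1// mulr1 mul1r addrC subrK.
have p0 : 0 < p by rewrite (lt_trans _ p1).
have q0 : 0 < p / (p - 1) by rewrite divr_gt0// subr_gt0.
have young := @conjugate_powR _ x (y `^ (p - 1)) p (p / (p - 1)) x0 (powR_ge0 _ _) p0 q0.
have : p^-1 + (p / (p - 1))^-1 = 1 by rewrite invf_div; field; rewrite ?gt_eqF.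
move/young; rewrite -powRrM [(p - 1) * _]mulrC divfK ?subr_eq0 ?gt_eqF//.
rewrite -(ler_pM2l p0) -[X in p * _ * (x - X)]mul1r.
have -> : p * (x `^ p / p + y `^ p / (p / (p - 1))) = x `^ p + (p - 1) * y `^ p.
  by field; rewrite ?subr_eq0 ?gt_eqF.
by rewrite -(mulr_powRB1 y0 p0); lra.
Qed.

(** Tangents at [x + 1], first for the exponent [a + 1], then for [a]. The error term is shared with
    [powR_pred_le], so that arrivals and departures can be added. *)
Lemma powR_succ_le a x : 1 <= a -> 0 <= x ->
  ((x + 1) `^ (a + 1) - x `^ (a + 1)) / (a + 1) <= x `^ a + a * (x + 1) `^ (a - 1).
Proof.
move=> a1 x0; have x10 : 0 <= x + 1 by rewrite addr_ge0.
rewrite ler_pdivrMr; last by lra.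
have := powR_tangent_le a1 x0 x10.
have /powR_tangent_le/(_ x0 x10) : 1 <= a + 1 by lra.
rewrite addrK; nra.
Qed.

Lemma powR_pred_le a x : 1 <= a -> 1 <= x ->
  ((x - 1) `^ (a + 1) - x `^ (a + 1)) / (a + 1) <= - x `^ a + a * (x + 1) `^ (a - 1).
Proof.
move=> a1 x1; have x0 : 0 <= x by lra.
have xm0 : 0 <= x - 1 by rewrite subr_ge0.
rewrite ler_pdivrMr; last by lra.
have := powR_tangent_le a1 xm0 x0.
have /powR_tangent_le/(_ x0 xm0) : 1 <= a + 1 by lra.
have : x `^ (a - 1) <= (x + 1) `^ (a - 1).
  by rewrite ge0_ler_powR ?nnegrE ?subr_ge0 ?addr_ge0// lerDl.
rewrite addrK; nra.
Qed.

(** Concavity of the utility: the power [- a] of [r] is its derivative at [r]. At [x = 0] the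
    left-hand side is [-oo]. *)
Lemma fair_utility_tangent_le a x r : 1 <= a -> 0 <= x -> 0 < r ->
  (fair_utility a x <= fair_utility a r + (r `^ (- a) * (x - r))%:E)%E.
Proof.
rewrite /fair_utility => a1 x0 r0; have [->|aN1] := eqVneq a 1.
  move: x0; rewrite le_eqVlt => /predU1P[<-|x0]; first by rewrite /lne lexx leNye.
  rewrite !lne_EFin// -EFinD lee_fin powRN powRr1 ?(ltW r0)//.
  have := expR_ge1Dx (ln (x / r)).
  rewrite lnK ?posrE ?divr_gt0// ln_div ?posrE//.
  by rewrite mulrBr mulVf ?gt_eqF// [r^-1 * _]mulrC; lra.
have {aN1}a1 : 1 < a by rewrite lt_neqAle eq_sym aN1.
rewrite (gt_eqF r0)/= a1 andbT; case: eqVneq => [_|xN0]; first exact: leNye.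
have {xN0}x0 : 0 < x by rewrite lt_neqAle eq_sym xN0.
have b0 : 0 < a - 1 by lra.
rewrite -EFinD lee_fin.
(* With [y = x / r], the power is [expR ((1 - a) * ln y) >= 1 - (a - 1) * ln y], and
   [ln y <= y - 1]. *)
have : 1 - (a - 1) * (x / r - 1) <= (x / r) `^ (1 - a).
  rewrite /powR gt_eqF ?divr_gt0//.
  apply: le_trans (expR_ge1Dx _).
  have := expR_ge1Dx (ln (x / r)); rewrite lnK ?posrE ?divr_gt0//; nra.
have -> : (x / r) `^ (1 - a) = x `^ (1 - a) * r `^ (a - 1).
  by rewrite powRM ?invr_ge0 ?(ltW x0) ?(ltW r0)// -powR_inv1 ?(ltW r0)//
    -powRrM mulN1r opprB.
have ra : r `^ (1 - a) * r `^ (a - 1) = 1.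
  by rewrite -powRD ?subrKA ?addrN ?powRr0//= (gt_eqF r0) implybT.
have -> : r `^ (- a) = r `^ (1 - a) / r.
  rewrite -(powR_inv1 (ltW r0)) -powRD; last by rewrite (gt_eqF r0) implybT.
  by rewrite [1 - a]addrC addrK.
have X0 := powR_gt0 (1 - a) r0; set X := r `^ (1 - a) in ra X0 *.
set Y := r `^ _ in ra *; set Z := x `^ _.
move=> ZY; have XZ : X * (1 - (a - 1) * (x / r - 1)) <= Z.
  by rewrite -[Z]mulr1 -[in Z * 1]ra [Z * _]mulrCA ler_wpM2l// ltW.
have -> : X / r * (x - r) = X * (x / r - 1) by field; rewrite gt_eqF.
rewrite -opprB !invrN !mulrN -(ler_pM2r b0) mulrDl !mulNr !divfK ?gt_eqF//.
by lra.
Qed.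

(* The threshold [2 `^ a * a * c / (rho * e)] is at least [1], and the first
   term dominates beyond it. *)
Lemma route_drift_le a c e rho x :
  1 <= a -> 0 < c -> 0 < e -> 0 < rho -> e * rho <= c -> 0 <= x ->
  - (e * (rho * x `^ a)) + 2 * a * c * (x + 1) `^ (a - 1) <=
  2 * a * c * (2 `^ (a + 1) * a * c / rho) `^ (a - 1) / e `^ (a - 1).
Proof.
move=> a1 c0 e0 rho0 ec x0.
have a0 : 0 < a by lra.
have am0 : 0 <= a - 1 by lra.
set y := 2 `^ a * a * c / (rho * e).
have y1 : 1 <= y.
  rewrite ler_pdivlMr ?mulr_gt0// mul1r mulrC; apply: le_trans ec _.
  rewrite ler_peMl ?(ltW c0)//.
  have : 2 `^ 1 <= 2 `^ a :> R by rewrite ler_powR// ler1n.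
  by rewrite powRr1//; nra.
have -> : 2 * a * c * (2 `^ (a + 1) * a * c / rho) `^ (a - 1) / e `^ (a - 1) =
    2 * a * c * (2 * y) `^ (a - 1).
  have -> : (e `^ (a - 1))^-1 = e^-1 `^ (a - 1).
    rewrite -[LHS]powR_inv1 ?powR_ge0// -(powR_inv1 (ltW e0)) -!powRrM.
    by rewrite mulrC.
  rewrite -mulrA -powRM ?invr_ge0 ?(ltW e0)//; last first.
    by rewrite !mulr_ge0 ?powR_ge0 ?invr_ge0// ltW.
  have -> : 2 `^ (a + 1) = 2 `^ a * 2 :> R.
    by rewrite powRD ?powRr1// pnatr_eq0 implybT.
  by rewrite /y; congr (_ * _ `^ _); field; rewrite !gt_eqF.
(* Up to [y], the negative term is dropped and [x + 1 <= 2 * y]. Beyond [y], the left-hand side is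
   nonpositive, by [x + 1 <= 2 * x]. *)
have [xy|yx] := lerP x y.
  apply: (@le_trans _ _ (2 * a * c * (x + 1) `^ (a - 1))).
    by rewrite gerDr oppr_le0 !mulr_ge0 ?powR_ge0// ltW.
  rewrite ler_wpM2l ?mulr_ge0 ?(ltW a0) ?(ltW c0)//.
  by rewrite ge0_ler_powR// ?nnegrE; lra.
have x1 : 1 < x by exact: le_lt_trans yx.
apply: (@le_trans _ _ 0); last first.
  by rewrite !mulr_ge0 ?powR_ge0// ltW.
have : (x + 1) `^ (a - 1) <= 2 `^ (a - 1) * x `^ (a - 1).
  by rewrite -powRM// ge0_ler_powR// ?nnegrE; lra.
rewrite -(mulr_powRB1 x0 a0).
have : 2 * 2 `^ (a - 1) = 2 `^ a :> R by rewrite mulr_powRB1.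
move: yx; rewrite /y ltr_pdivrMr ?mulr_gt0//.
have := powR_ge0 x (a - 1).
set X := x `^ _; set Z := (x + 1) `^ _; set U := 2 `^ (a - 1); set V := 2 `^ a.
move=> X0 yx UV ZX.
have : a * c * 2 * Z <= a * c * 2 * (U * X) by rewrite ler_wpM2l// !mulr_ge0// ltW.
have : (V * a * c) * X <= (x * (rho * e)) * X by rewrite ler_wpM2r// ltW.
by rewrite -UV; lra.
Qed.

End PowerInequalities.

(** * Drift of the Lyapunov function *)

Section FairPolicy.
Context (R : realType) (J I : nat) (route : 'I_I -> {set 'I_J}) (C : 'cV[R]_J)
  (kappa : 'cV[R]_I) (alpha : R).
Hypotheses (route_nonempty : forall i, route i != finset.set0)
  (C_gt0 : positive_vec C) (kappa_gt0 : positive_vec kappa) (alpha_ge1 : 1 <= alpha).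
Local Notation A := (incidence R route).
Implicit Types (n r : 'cV[R]_I) (e : R).

Definition total_capacity : R := \sum_j C j 0.

Lemma route_resource i : {j | j \in route i}.
Proof. by apply/sigW/set0Pn. Qed.

Lemma capacity_le_total j : C j 0 <= total_capacity.
Proof.
rewrite /total_capacity (bigD1 j)//= lerDl sumr_ge0// => k _; exact/ltW/C_gt0.
Qed.

Lemma total_capacity_gt0 (i : 'I_I) : 0 < total_capacity.
Proof. by have [j _] := route_resource i; exact: lt_le_trans (capacity_le_total j). Qed.

Lemma incidence_ge0 j i : 0 <= A j i.
Proof. by rewrite mxE ler0n. Qed.

(** The predicate lets this serve both for the busy routes of an allocation and for all routes under
    a scaled load. *)
Lemma route_load_le (P : pred 'I_I) (x : 'cV[R]_I) (i : 'I_I) :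
  (forall k, P k -> 0 <= x k 0) -> P i ->
  (forall j, \sum_(k | P k) A j k * x k 0 <= C j 0) -> x i 0 <= total_capacity.
Proof.
move=> x0 Pi xC; have [j ij] := route_resource i.
apply: le_trans (capacity_le_total j); apply: le_trans (xC j).
rewrite (bigD1 i)//= mxE ij mul1r lerDl sumr_ge0// => k /andP[Pk _].
by rewrite mulr_ge0 ?incidence_ge0// x0.
Qed.

Context (Lambda : 'cV[R]_I -> 'cV[R]_I).
Hypothesis fair_Lambda : is_fair_policy A C kappa alpha Lambda.

Lemma fair_policy_eq0 n i : (forall k, 0 <= n k 0) -> n i 0 = 0 -> Lambda n i 0 = 0.
Proof. by move=> n0 ni; have [-> //] := fair_Lambda n0; rewrite ni ltxx. Qed.

Lemma fair_policy_bounds n i : (forall k, 0 <= n k 0) ->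
  0 <= Lambda n i 0 <= total_capacity.
Proof.
move=> n0; have := n0 i; rewrite le_eqVlt => /predU1P[/esym ni|ni].
  by rewrite fair_policy_eq0// lexx ltW//; exact: total_capacity_gt0.
have nN0 : n != 0 by apply: contraTneq ni => ->; rewrite mxE ltxx.
have [_ /(_ nN0)[[L0 LC] _]] := fair_Lambda n0.
by rewrite L0//=; apply: (route_load_le (P := fun i => 0 < n i 0)).
Qed.

(* First-order optimality: the objective is concave, so its linearization at a
   feasible point [r] increases towards the maximizer. *)
Lemma fair_policy_tangent_ge0 n r : (forall k, 0 <= n k 0) -> positive_vec r ->
  (forall j, (A *m r) j 0 <= C j 0) ->
  0 <= \sum_i kappa i 0 * n i 0 `^ alpha * (r i 0 `^ (- alpha) * (Lambda n i 0 - r i 0)).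
Proof.
move=> n0 r0 rC.
have alphaN0 : alpha != 0 by rewrite gt_eqF// (lt_le_trans ltr01).
rewrite (bigID (fun i => 0 < n i 0))/= addrC big1 ?add0r; last first.
  move=> i; rewrite lt_neqAle n0 andbT negbK => /eqP <-.
  by rewrite powR0// mulr0 mul0r.
have [nE|nN0] := eqVneq n 0.
  by rewrite big1// => i _; rewrite nE mxE powR0// mulr0 mul0r.
have [_ /(_ nN0)[[L0 LC] Lmax]] := fair_Lambda n0.
have /Lmax : fair_feasible A C n r.
  split=> [i _|j]; first exact/ltW/r0.
  apply: le_trans (rC j); rewrite mxE [leRHS](bigID (fun i => 0 < n i 0))/= lerDl.
  by rewrite sumr_ge0// => i _; rewrite mulr_ge0 ?incidence_ge0//; exact/ltW/r0.
(* The utilities at [r] are finite because [r] is positive, so they can be cancelled in the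
   reals. *)
have utilityE i : fair_utility alpha (r i 0) = (fine (fair_utility alpha (r i 0)))%:E.
  rewrite /fair_utility; case: ifP => _; first by rewrite lne_EFin.
  by rewrite gt_eqF.
rewrite /fair_objective => rL.
have : (\sum_(i | (0 < n i 0)%R) (kappa i 0 * n i 0 `^ alpha)%R%:E * fair_utility alpha (r i 0%R)
    <= \sum_(i | (0 < n i 0)%R) (kappa i 0 * n i 0 `^ alpha)%R%:E *
      (fair_utility alpha (r i 0%R) + (r i 0 `^ (- alpha) * (Lambda n i 0 - r i 0))%R%:E))%E.
  apply: le_trans rL _; apply: lee_sum => i ni.
  rewrite lee_pmul2l ?lte_fin ?mulr_gt0 ?powR_gt0//.
  by apply: fair_utility_tangent_le => //; exact: L0.
pose w i := kappa i 0 * n i 0 `^ alpha; pose u i := fine (fair_utility alpha (r i 0)).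
rewrite (eq_bigr (fun i => (w i * u i)%:E)); last first.
  by move=> i _; rewrite /u [RHS]EFinM -utilityE.
rewrite [X in (_ <= X)%E](eq_bigr (fun i =>
    (w i * u i + w i * (r i 0 `^ (- alpha) * (Lambda n i 0 - r i 0)))%:E)); last first.
  by move=> i _; rewrite /u -mulrDr [RHS]EFinM EFinD -utilityE.
by rewrite !sumEFin lee_fin big_split/= lerDl.
Qed.

(** The tangent inequality at [(1 + e) *: rho]: the positive power of [1 + e] factors out, and the
    excess [e *: rho] gives the negative drift. *)
Lemma fair_policy_drift_le n e (rho : 'cV[R]_I) :
  (forall k, 0 <= n k 0) -> positive_vec rho -> 0 < e ->
  (forall j, (1 + e) * (A *m rho) j 0 <= C j 0) ->
  \sum_i kappa i 0 * n i 0 `^ alpha * (rho i 0 `^ (- alpha) * (rho i 0 - Lambda n i 0)) <=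
  - (e * \sum_i kappa i 0 * n i 0 `^ alpha * (rho i 0 `^ (- alpha) * rho i 0)).
Proof.
move=> n0 rho0 e0 eC; have e10 : 0 < 1 + e by lra.
have scaled_gt0 : positive_vec ((1 + e) *: rho) by move=> i; rewrite mxE mulr_gt0.
have scaled_le j : (A *m ((1 + e) *: rho)) j 0 <= C j 0 by rewrite -scalemxAr mxE.
have := fair_policy_tangent_ge0 n0 scaled_gt0 scaled_le.
have scaleE i : kappa i 0 * n i 0 `^ alpha *
    (((1 + e) *: rho) i 0 `^ (- alpha) * (Lambda n i 0 - ((1 + e) *: rho) i 0)) =
    (1 + e) `^ (- alpha) * (kappa i 0 * n i 0 `^ alpha *
      (rho i 0 `^ (- alpha) * (Lambda n i 0 - (1 + e) * rho i 0))).
  by rewrite mxE powRM ?(ltW e10) ?(ltW (rho0 i))//; ring.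
under eq_bigr do rewrite scaleE.
rewrite -mulr_sumr pmulr_rge0 ?powR_gt0//.
set S := bigop _ _ _ => S0; rewrite -subr_ge0 [leRHS](_ : _ = S)//.
rewrite /S mulr_sumr -sumrN -sumrB.
by apply: eq_bigr => i _; ring.
Qed.

(** The bound of [route_drift_le] with the total capacity as [c], stripped of its power of the
    gap. *)
Definition route_drift_bound (r : R) : R :=
  2 * alpha * total_capacity *
    (2 `^ (alpha + 1) * alpha * total_capacity / r) `^ (alpha - 1).

(* Chosen so that [mu i 0] times it is the weight of route [i] in the first-order
   optimality condition at [rho]. *)
Definition lyapunov_coef (mu nu : 'cV[R]_I) (i : 'I_I) : R :=
  kappa i 0 * traffic_intensity mu nu i 0 `^ (- alpha) / mu i 0.

Definition lyapunov (mu nu : 'cV[R]_I) (n : 'cV[nat]_I) : R :=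
  \sum_i lyapunov_coef mu nu i * ((n i 0)%:R `^ (alpha + 1) / (alpha + 1)).

(* Equal to [n] if route [i] is empty; [Lambda] then gives it rate [0]. *)
Definition remove_flow (n : 'cV[nat]_I) (i : 'I_I) : 'cV[nat]_I :=
  \col_k (n k 0%R - (k == i))%N.

Definition drift_bound (rho : 'cV[R]_I) : R :=
  \sum_i kappa i 0 * rho i 0 `^ (- alpha) * route_drift_bound (rho i 0).

Section Drift.
Context (mu nu : 'cV[R]_I).
Hypotheses (mu_gt0 : positive_vec mu) (nu_gt0 : positive_vec nu).
Local Notation rho := (traffic_intensity mu nu).

Lemma traffic_intensity_gt0 : positive_vec rho.
Proof. by move=> i; rewrite mxE divr_gt0. Qed.

Lemma lyapunov_coef_gt0 i : 0 < lyapunov_coef mu nu i.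
Proof. by rewrite divr_gt0// mulr_gt0// powR_gt0//; exact: traffic_intensity_gt0. Qed.

Lemma lyapunov_ge (b : R) (n : 'cV[nat]_I) i : 0 <= b -> b <= (n i 0)%:R ->
  lyapunov_coef mu nu i * (b `^ (alpha + 1) / (alpha + 1)) <= lyapunov mu nu n.
Proof.
move=> b0 bn; have alpha1 : 0 < alpha + 1 by have := alpha_ge1; lra.
rewrite /lyapunov (bigD1 i)//= -[leLHS]addr0 lerD//; last first.
  apply: sumr_ge0 => k _.
  by rewrite mulr_ge0 ?(ltW (lyapunov_coef_gt0 _))// divr_ge0 ?powR_ge0 ?ltW.
rewrite ler_wpM2l ?(ltW (lyapunov_coef_gt0 _))// ler_wpM2r ?invr_ge0 ?(ltW alpha1)//.
by rewrite ge0_ler_powR ?nnegrE ?(ltW alpha1).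
Qed.

Lemma lyapunov0 : lyapunov mu nu 0 = 0.
Proof.
rewrite /lyapunov big1// => i _; rewrite mxE powR0 ?mul0r ?mulr0//.
by rewrite gt_eqF//; have := alpha_ge1; lra.
Qed.

Lemma lyapunov_diff (n m : 'cV[nat]_I) i : (forall k, k != i -> m k 0 = n k 0) ->
  lyapunov mu nu m - lyapunov mu nu n = lyapunov_coef mu nu i *
    (((m i 0)%:R `^ (alpha + 1) - (n i 0)%:R `^ (alpha + 1)) / (alpha + 1)).
Proof.
move=> mn; rewrite /lyapunov (bigD1 i)//= [X in _ - X](bigD1 i)//=.
rewrite [X in _ + X - _](eq_bigr (fun k => lyapunov_coef mu nu k *
    ((n k 0)%:R `^ (alpha + 1) / (alpha + 1)))); last by move=> k /mn ->.
by rewrite opprD addrACA subrr addr0; ring.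
Qed.

(** Fairness controls the first-order terms only after summation over routes. The resulting negative
    drift splits again by route, and [route_drift_le] sets it against the second-order error of
    each. *)
Lemma lyapunov_drift_le (n : 'cV[nat]_I) e : 0 < e ->
  (forall j, (1 + e) * (A *m rho) j 0 <= C j 0) ->
  \sum_i (nu i 0 * (lyapunov mu nu (n + unit_vec i) - lyapunov mu nu n) +
    mu i 0 * Lambda (real_vec R n) i 0 *
      (lyapunov mu nu (remove_flow n i) - lyapunov mu nu n)) <=
  drift_bound rho / e `^ (alpha - 1).
Proof.
move=> e0 eC; set L := Lambda (real_vec R n).
have rho0 := traffic_intensity_gt0.
have n0 k : 0 <= real_vec R n k 0 by rewrite mxE.
have L01 i : 0 <= L i 0 <= total_capacity by exact: fair_policy_bounds.
pose w i := kappa i 0 * rho i 0 `^ (- alpha).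
have w0 i : 0 < w i by rewrite mulr_gt0// powR_gt0.
have coef_mu i : lyapunov_coef mu nu i * mu i 0 = w i by rewrite divfK ?gt_eqF.
have coef_nu i : lyapunov_coef mu nu i * nu i 0 = w i * rho i 0.
  by rewrite -coef_mu mxE -mulrA [mu i 0 * _]mulrC divfK ?gt_eqF.
have rho_le i : (1 + e) * rho i 0 <= total_capacity.
  have := @route_load_le predT ((1 + e) *: rho) i; rewrite mxE; apply=> //.
    by move=> k _; rewrite mxE mulr_ge0 ?(ltW (rho0 _))//; lra.
  move=> j; apply: le_trans (eC j); rewrite mxE mulr_sumr ler_sum// => k _.
  by rewrite [((1 + e) *: rho) k 0]mxE mulrCA.
pose x i : R := (n i 0)%:R.
have x0 i : 0 <= x i by rewrite ler0n.
have up i : lyapunov mu nu (n + unit_vec i) - lyapunov mu nu n <=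
    lyapunov_coef mu nu i * (x i `^ alpha + alpha * (x i + 1) `^ (alpha - 1)).
  rewrite (@lyapunov_diff n _ i); last first.
    by move=> k ki; rewrite mxE [unit_vec i k 0]mxE (negbTE ki) addr0.
  rewrite ler_wpM2l ?(ltW (lyapunov_coef_gt0 i))//.
  have -> : ((n + unit_vec i)%R i 0%R)%:R = x i + 1.
    by rewrite mxE [unit_vec i i 0]mxE !eqxx natrD.
  exact: powR_succ_le.
(* The factor [L i 0] is kept because [powR_pred_le] needs a flow on the route; on an empty route
   [L i 0] is [0]. *)
have down i : L i 0 * (lyapunov mu nu (remove_flow n i) - lyapunov mu nu n) <=
    L i 0 * (lyapunov_coef mu nu i *
      (- x i `^ alpha + alpha * (x i + 1) `^ (alpha - 1))).
  have [Li0 _] := andP (L01 i).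
  have [ni|ni] := posnP (n i 0).
    by rewrite /L fair_policy_eq0 ?mul0r// mxE ni.
  rewrite ler_wpM2l// (@lyapunov_diff n _ i); last first.
    by move=> k ki; rewrite mxE (negbTE ki) subn0.
  rewrite ler_wpM2l ?(ltW (lyapunov_coef_gt0 i))//.
  have -> : (remove_flow n i i 0)%:R = x i - 1 by rewrite mxE eqxx natrB.
  by apply: powR_pred_le => //; rewrite ler1n.
(* The second-order terms carry the factor [rho i 0 + L i 0], at most twice the total capacity. *)
apply: (@le_trans _ _ (\sum_i (w i * x i `^ alpha * (rho i 0 - L i 0) +
    w i * (2 * alpha * total_capacity * (x i + 1) `^ (alpha - 1))))).
  apply: ler_sum => i _.
  have [Li0 LiC] := andP (L01 i).
  have := ler_wpM2l (ltW (nu_gt0 i)) (up i).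
  rewrite [leRHS]mulrA [nu i 0 * lyapunov_coef _ _ _]mulrC coef_nu => up_i.
  have := ler_wpM2l (ltW (mu_gt0 i)) (down i).
  set Y := (x i + 1) `^ (alpha - 1) in up_i *; set X := x i `^ alpha in up_i *.
  have -> : mu i 0 * (L i 0 * (lyapunov_coef mu nu i * (- X + alpha * Y))) =
      w i * L i 0 * (- X + alpha * Y) by rewrite -coef_mu; ring.
  rewrite mulrA => down_i.
  have rhoC : rho i 0 <= total_capacity.
    by apply: le_trans (rho_le i); rewrite ler_peMl ?(ltW (rho0 i))// lerDl ltW.
  have : w i * (alpha * Y) * (rho i 0 + L i 0) <= w i * (alpha * Y) * (2 * total_capacity).
    apply: ler_wpM2l; last by lra.
    apply: mulr_ge0; first exact/ltW.
    by apply: mulr_ge0 (powR_ge0 _ _); exact: le_trans ler01 alpha_ge1.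
  by lra.
rewrite big_split/=.
have := fair_policy_drift_le n0 rho0 e0 eC.
rewrite (eq_bigr (fun i => w i * x i `^ alpha * (rho i 0 - L i 0))); last first.
  by move=> i _; rewrite mxE /w; ring.
set S := \sum_i w i * _ * _ => S_le.
apply: (@le_trans _ _ (\sum_i w i * (- (e * (rho i 0 * x i `^ alpha)) +
    2 * alpha * total_capacity * (x i + 1) `^ (alpha - 1)))).
  under [leRHS]eq_bigr do rewrite mulrDr.
  rewrite big_split/= lerD2r; apply: le_trans S_le _.
  rewrite mulr_sumr -sumrN; apply: ler_sum => i _.
  by rewrite mxE /w /x; lra.
rewrite /drift_bound mulr_suml; apply: ler_sum => i _.
rewrite -[leRHS]mulrA -/(w i); apply: ler_wpM2l; first exact/ltW.
apply: route_drift_le => //; first exact: total_capacity_gt0.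
by apply: le_trans (rho_le i); rewrite mulrDl mul1r lerDr ltW.
Qed.

End Drift.

End FairPolicy.

(** * The gap as an attained supremum *)

Section Gap.
Context (R : realType) (J I : nat) (A : 'M[R]_(J, I)) (C : 'cV[R]_J) (rho : 'cV[R]_I).
Hypotheses (C_gt0 : positive_vec C) (load_ge0 : forall j, 0 <= (A *m rho) j 0)
  (load_lt : forall j, (A *m rho) j 0 < C j 0).

(** The loaded resource [j0] bounds the set, so [sup] is a true least upper bound, and nonstrict
    constraints pass to it. *)
Lemma gapP (j0 : 'I_J) : 0 < (A *m rho) j0 0 ->
  0 < gap A C rho /\ forall j, (1 + gap A C rho) * (A *m rho) j 0 <= C j 0.
Proof.
move=> load0; rewrite /gap; set E := [set e | _].
have E_le j e : 0 < (A *m rho) j 0 -> E e -> e <= C j 0 / (A *m rho) j 0 - 1.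
  move=> load_gt0 [e0 /(_ j)]; rewrite -ler_pdivlMr//; lra.
have E_ub : has_ubound E.
  by exists (C j0 0 / (A *m rho) j0 0 - 1) => e; exact: E_le.
have [e Ee] : E !=set0.
  (* For such [e], the load scaled by [1 + e] is at most the load plus [e * C j 0], hence at most
     [C j 0]. Dividing by the capacity also covers resources without load. *)
  exists (\big[Num.min/1]_j ((C j 0 - (A *m rho) j 0) / C j 0)); split.
    by apply: lt_bigmin => // j _; rewrite divr_gt0 ?subr_gt0.
  move=> j; have := bigmin_le 1 j (fun j => (C j 0 - (A *m rho) j 0) / C j 0).
  set e := \big[_/_]_j _; rewrite ler_pdivlMr// => eC.
  have e0 : 0 < e by apply: lt_bigmin => // k _; rewrite divr_gt0 ?subr_gt0.
  have := load_ge0 j; have := load_lt j; nra.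
split; first by apply: lt_le_trans (ub_le_sup E_ub Ee); case: Ee.
move=> j; have := load_ge0 j; rewrite le_eqVlt => /predU1P[<-|load_gt0].
  by rewrite mulr0 ltW.
rewrite -ler_pdivlMr// -lerBrDl; apply: ge_sup; first by exists e.
by move=> e' /E_le -/(_ j load_gt0).
Qed.

End Gap.

(** * Transitions of the flow process *)

Section FlowRates.
Context (R : realType) (I : nat) (mu nu : 'cV[R]_I) (Lambda : 'cV[R]_I -> 'cV[R]_I).
Implicit Types n m : 'cV[nat]_I.

(** An empty route makes [remove_flow] return [n], which the filter discards. *)
Definition flow_neighbors n : seq 'cV[nat]_I :=
  [seq m <- undup ([seq n + unit_vec i | i <- enum 'I_I] ++
                   [seq remove_flow n i | i <- enum 'I_I]) | m != n].

Lemma flow_neighbors_uniq n : uniq (flow_neighbors n).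
Proof. by rewrite filter_uniq// undup_uniq. Qed.

Lemma flow_neighbors_irr n : n \notin flow_neighbors n.
Proof. by rewrite mem_filter eqxx. Qed.

Lemma add_unit_vec_neq n i : n + unit_vec i != n.
Proof.
apply/eqP => /matrixP/(_ i 0); rewrite !mxE !eqxx => /eqP.
by rewrite -[X in _ == X]addn0 eqn_add2l.
Qed.

Lemma add_unit_vec_neighbor n i : n + unit_vec i \in flow_neighbors n.
Proof.
rewrite mem_filter add_unit_vec_neq mem_undup mem_cat.
by apply/orP; left; apply/mapP; exists i; rewrite ?mem_enum.
Qed.

Lemma remove_flow_neighbor n i : (0 < n i 0%R)%N -> remove_flow n i \in flow_neighbors n.
Proof.
move=> ni; rewrite mem_filter mem_undup mem_cat; apply/andP; split; last first.
  by apply/orP; right; apply/mapP; exists i; rewrite ?mem_enum.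
apply/eqP => /matrixP/(_ i 0); rewrite mxE eqxx => /eqP.
by rewrite subn1 ltn_eqF// ltn_predL.
Qed.

Lemma eq_add_unit_vec n m i :
  (n == m + unit_vec i) = (0 < n i 0%R)%N && (m == remove_flow n i).
Proof.
apply/eqP/andP => [->|[ni /eqP ->]].
  split; first by rewrite !mxE !eqxx addn_gt0 orbT.
  apply/eqP/matrixP => k l; rewrite !ord1 !mxE eqxx andbT.
  by case: (k == i); [exact: (esym (addnK 1 _))|exact: (esym (addnK 0 _))].
apply/matrixP => k l; rewrite !ord1 !mxE eqxx andbT.
have [->|_] := eqVneq k i; first exact: (esym (subnK ni)).
by rewrite subn0 addr0.
Qed.

Lemma flow_rates_eq0 n m : m != n -> m \notin flow_neighbors n ->
  flow_rates mu nu Lambda n m = 0.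
Proof.
move=> mn mN; rewrite /flow_rates big1// => i _.
have /negPf -> : m != n + unit_vec i.
  by apply: contraNneq mN => ->; exact: add_unit_vec_neighbor.
have /negPf -> : n != m + unit_vec i.
  rewrite eq_add_unit_vec; apply: contraNN mN => /andP[ni /eqP ->].
  exact: remove_flow_neighbor.
by rewrite !mul0r addr0.
Qed.

Lemma big_seq_indicator (T : eqType) (r : seq T) (x : T) (g : T -> R) :
  uniq r -> x \in r -> \sum_(m <- r) (m == x)%:R * g m = g x.
Proof.
move=> ur xr; rewrite (bigD1_seq x)//= eqxx mul1r big1 ?addr0// => m /negPf ->.
by rewrite mul0r.
Qed.

(** Each indicator selects one neighbor. On an empty route the departure indicator selects none,
    which matches [Lambda] being [0] there. *)
Lemma sum_flow_rates n (g : 'cV[nat]_I -> R) :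
  (forall i, n i 0 = 0%N -> Lambda (real_vec R n) i 0 = 0) ->
  \sum_(m <- flow_neighbors n) flow_rates mu nu Lambda n m * g m =
  \sum_i (nu i 0 * g (n + unit_vec i) +
          mu i 0 * Lambda (real_vec R n) i 0 * g (remove_flow n i)).
Proof.
move=> L0; under eq_bigr do rewrite mulr_suml.
rewrite exchange_big/=; apply: eq_bigr => i _.
under eq_bigr do rewrite mulrDl -!mulrA.
rewrite big_split/=; congr (_ + _).
  exact: (big_seq_indicator (fun m => nu i 0 * g m)
    (flow_neighbors_uniq n) (add_unit_vec_neighbor n i)).
have [ni|ni] := posnP (n i 0).
  by rewrite L0// mulr0 mul0r big1// => m _; rewrite mul0r !mulr0.
under eq_bigr do rewrite eq_add_unit_vec ni.
rewrite -mulrA.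
exact: (big_seq_indicator (fun m => mu i 0 * (Lambda (real_vec R n) i 0 * g m))
  (flow_neighbors_uniq n) (remove_flow_neighbor ni)).
Qed.

End FlowRates.

(** * The load-dependent constant *)

Section LoadConstant.
Context (R : realType) (J I : nat) (C : 'cV[R]_J) (kappa : 'cV[R]_I) (alpha : R).

(** The sum stands in for the maximum of its terms, i.e. for the inverse of the least Lyapunov
    coefficient up to [alpha + 1]. The final [1] gives strict positivity even without routes. *)
Definition load_constant (x : 'cV[R]_I * 'cV[R]_I) : R :=
  drift_bound C kappa alpha (traffic_intensity x.1 x.2) *
    (\sum_i (alpha + 1) / lyapunov_coef kappa alpha x.1 x.2 i) + 1.

Lemma continuous_powR (p x : R) : 0 < x -> {for x, continuous (fun y => y `^ p)}.
Proof.
move=> x0; apply: differentiable_continuous; apply/derivable1_diffP.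
by apply: derivable_powR; rewrite in_itv/= x0.
Qed.

Hypotheses (kappa_gt0 : positive_vec kappa) (alpha_ge1 : 1 <= alpha)
  (cap_gt0 : 'I_I -> 0 < total_capacity C).

Lemma drift_bound_ge0 (rho : 'cV[R]_I) : positive_vec rho ->
  0 <= drift_bound C kappa alpha rho.
Proof.
move=> rho0; apply: sumr_ge0 => i _; have := cap_gt0 i => c0.
rewrite !mulr_ge0 ?powR_ge0 ?(ltW (kappa_gt0 i)) ?(ltW c0)//.
exact: le_trans ler01 alpha_ge1.
Qed.

Lemma load_constant_is_load_function : is_load_function load_constant.
Proof.
have alpha0 : 0 < alpha by apply: lt_le_trans alpha_ge1.
split=> [x [mu0 nu0]|].
  rewrite ltr_wpDl// mulr_ge0//.
    by apply: drift_bound_ge0; exact: traffic_intensity_gt0.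
  apply: sumr_ge0 => i _.
  by rewrite divr_ge0// ?ltW ?addr_gt0// lyapunov_coef_gt0.
apply: continuous_in_subspaceT => x /set_mem[mu0 nu0].
have mu_cvg i : (y.1 : 'cV[R]_I) i 0 @[y --> x] --> x.1 i 0.
  by apply: (@cvg_comp _ _ _ fst (fun M : 'cV[R]_I => M i 0) (nbhs x) (nbhs x.1));
    [exact: cvg_fst|exact: coord_continuous].
have nu_cvg i : (y.2 : 'cV[R]_I) i 0 @[y --> x] --> x.2 i 0.
  by apply: (@cvg_comp _ _ _ snd (fun M : 'cV[R]_I => M i 0) (nbhs x) (nbhs x.2));
    [exact: cvg_snd|exact: coord_continuous].
have rho_cvg i : traffic_intensity y.1 y.2 i 0 @[y --> x] --> traffic_intensity x.1 x.2 i 0.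
  under eq_fun do rewrite mxE.
  by rewrite mxE; apply: cvgM => //; apply: cvgV => //; rewrite gt_eqF.
have rho0 := traffic_intensity_gt0 mu0 nu0.
apply: cvgD; last exact: cvg_cst.
have powR_rho_cvg p i : traffic_intensity y.1 y.2 i 0 `^ p @[y --> x] -->
    traffic_intensity x.1 x.2 i 0 `^ p.
  exact: (cvg_comp _ _ (rho_cvg i) (continuous_powR (p := p) (rho0 i))).
apply: cvgM; (apply: cvg_big => //=; first by move=> ?; exact: add_continuous) => i _.
  apply: cvgM; first by apply: cvgM; [exact: cvg_cst|].
  apply: cvgM; first exact: cvg_cst.
  apply: (@cvg_comp _ _ _ _ (fun y : R => y `^ (alpha - 1))); last first.
    apply: continuous_powR; rewrite !divr_gt0 ?mulr_gt0 ?powR_gt0//; exact: cap_gt0.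
  by apply: cvgM; [exact: cvg_cst|apply: cvgV => //; rewrite gt_eqF].
apply: cvgM; first exact: cvg_cst.
apply: cvgV; first by rewrite gt_eqF// lyapunov_coef_gt0.
apply: cvgM; first by apply: cvgM; [exact: cvg_cst|].
by apply: cvgV => //; rewrite gt_eqF.
Qed.

End LoadConstant.

(** Flow counts are integers: with [m.+1] the least integer above or equal to [b], a supremum
    exceeding [m] forces some count to be at least [m.+1]. *)
Lemma running_max_geE (R : realType) (Om : Type) (I : nat)
    (N : R -> Om -> 'cV[nat]_I) (T b : R) : 0 < b ->
  [set w | (b%:E <= running_max N T w)%E] =
  hitting_event N [set n | exists i, b <= (n i 0)%:R] T.
Proof.
move=> b0; apply/seteqP; split => w /=; last first.
  move=> [t [tT [i bN]]]; apply: (@le_trans _ _ ((N t w i 0)%:R)%:E).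
    by rewrite lee_fin.
  by apply: ereal_sup_ubound; exists t, i.
have exm : exists m, b <= m%:R.
  by exists (Num.truncn b).+1; exact/ltW/Num.Theory.truncnS_gt.
case: (ex_minnP exm) => -[|m] bm m_min; first by rewrite leNgt b0 in bm.
have mb : m%:R < b by rewrite ltNge; apply/negP => /m_min; rewrite ltnn.
move=> bN; have : (m%:R%:E < running_max N T w)%E.
  by apply: lt_le_trans bN; rewrite lte_fin.
move=> /ereal_sup_gt[_ [t [i [tT ->]]]]; rewrite lte_fin ltr_nat => mN.
by exists t; split=> //; exists i; rewrite (le_trans bm)// ler_nat.
Qed.

(** * The maximal inequality's hypotheses for the flow process *)

Section FlowProcess.
Context (R : realType) (J I : nat) (route : 'I_I -> {set 'I_J}) (C : 'cV[R]_J)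
  (kappa : 'cV[R]_I) (alpha : R).
Hypotheses (route_nonempty : forall i, route i != finset.set0)
  (C_gt0 : positive_vec C) (kappa_gt0 : positive_vec kappa) (alpha_ge1 : 1 <= alpha).
Local Notation A := (incidence R route).
Context (mu nu : 'cV[R]_I) (Lambda : 'cV[R]_I -> 'cV[R]_I).
Hypotheses (mu_gt0 : positive_vec mu) (nu_gt0 : positive_vec nu)
  (fair_Lambda : is_fair_policy A C kappa alpha Lambda).
Local Notation rho := (traffic_intensity mu nu).
Local Notation F := (lyapunov kappa alpha mu nu).
Local Notation q := (flow_rates mu nu Lambda).

Implicit Types n m : 'cV[nat]_I.

Let Lambda_bounds n i :
  0 <= Lambda (real_vec R n) i 0 <= total_capacity C.
Proof. by apply: (fair_policy_bounds _ C_gt0 fair_Lambda) => // k; rewrite mxE. Qed.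

Let Lambda_eq0 n i : n i 0 = 0%N -> Lambda (real_vec R n) i 0 = 0.
Proof.
by move=> ni; apply: (fair_policy_eq0 fair_Lambda) => [k|]; rewrite mxE// ni.
Qed.

Lemma flow_rates_ge0 n m : 0 <= q n m.
Proof.
apply: sumr_ge0 => i _; have /andP[L0 _] := Lambda_bounds n i.
by rewrite addr_ge0// !mulr_ge0// ltW.
Qed.

Lemma flow_exit_rate_le n : \sum_(m <- flow_neighbors n) q n m <=
  \sum_i (nu i 0 + mu i 0 * total_capacity C).
Proof.
under eq_bigr do rewrite -[flow_rates _ _ _ _ _]mulr1.
rewrite (sum_flow_rates _ _ (fun=> 1) (@Lambda_eq0 n)); apply: ler_sum => i _.
have /andP[_ LC] := Lambda_bounds n i.
by rewrite !mulr1 lerD2l ler_wpM2l ?(ltW (mu_gt0 i)).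
Qed.

Lemma lyapunov_ge0 n : 0 <= F n.
Proof.
apply: sumr_ge0 => i _; apply: mulr_ge0; first by rewrite ltW// lyapunov_coef_gt0.
by rewrite divr_ge0 ?powR_ge0//; have := alpha_ge1; lra.
Qed.

Definition survival_bound (B : R) (n : 'cV[nat]_I) : R := Num.max 0 (1 - F n / B).

Lemma survival_bound01 B n : 0 < B -> 0 <= survival_bound B n <= 1.
Proof.
move=> B0; rewrite /survival_bound le_max lexx ge_max ler01/= gerBl.
by rewrite divr_ge0 ?lyapunov_ge0 ?ltW.
Qed.

(* Truncation from below keeps the drift bound: [Num.max 0 _] is convex and [0]
   is the minimum. *)
Lemma survival_bound_drift (B e : R) n : 0 < B -> 0 < e ->
  (forall j, (1 + e) * (A *m rho) j 0 <= C j 0) ->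
  - (drift_bound C kappa alpha rho / e `^ (alpha - 1) / B) <=
  \sum_(m <- flow_neighbors n) q n m * (survival_bound B m - survival_bound B n).
Proof.
move=> B0 e0 eC.
have K0 : 0 <= drift_bound C kappa alpha rho / e `^ (alpha - 1) / B.
  rewrite !divr_ge0 ?powR_ge0 ?(ltW B0)//; apply: drift_bound_ge0 => //.
    by move=> i; exact: total_capacity_gt0 i.
  exact: traffic_intensity_gt0.
have [FB|BF] := lerP (1 - F n / B) 0.
  rewrite (le_trans (y := 0)) ?oppr_le0//; apply: sumr_ge0 => m _.
  rewrite mulr_ge0 ?flow_rates_ge0// [survival_bound B n]max_l// subr0.
  by case/andP: (survival_bound01 m B0).
apply: (@le_trans _ _ (- ((\sum_(m <- flow_neighbors n) q n m * (F m - F n)) / B))).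
  rewrite lerN2 ler_wpM2r ?invr_ge0 ?(ltW B0)//.
  rewrite (sum_flow_rates _ _ (fun m => F m - F n) (@Lambda_eq0 n)).
  exact: (lyapunov_drift_le route_nonempty C_gt0 kappa_gt0 alpha_ge1 fair_Lambda).
rewrite mulr_suml -sumrN; apply: ler_sum => m _.
rewrite -mulrA -mulrN ler_wpM2l ?flow_rates_ge0//.
rewrite [survival_bound B n]max_r ?(ltW BF)//.
have : 1 - F m / B <= survival_bound B m by rewrite le_max lexx orbT.
by rewrite mulrBl; lra.
Qed.

(** A single term of [F] is enough. Replacing its coefficient by the sum makes the level independent
    of the route. *)
Lemma lyapunov_level_le (b : R) n i : 0 < b -> b <= (n i 0)%:R ->
  b `^ (alpha + 1) / (\sum_k (alpha + 1) / lyapunov_coef kappa alpha mu nu k) <= F n.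
Proof.
move=> b0 bn.
have alpha1 : 0 < alpha + 1 by have := alpha_ge1; lra.
have coef0 k := lyapunov_coef_gt0 alpha kappa_gt0 mu_gt0 nu_gt0 k.
apply: le_trans (lyapunov_ge kappa_gt0 alpha_ge1 mu_gt0 nu_gt0 (ltW b0) bn).
rewrite mulrCA ler_wpM2l ?powR_ge0//.
have term0 k : 0 < (alpha + 1) / lyapunov_coef kappa alpha mu nu k by rewrite divr_gt0.
have term_le : (alpha + 1) / lyapunov_coef kappa alpha mu nu i <=
    \sum_k (alpha + 1) / lyapunov_coef kappa alpha mu nu k.
  by rewrite [leRHS](bigD1 i)//= lerDl sumr_ge0// => k _; rewrite ltW.
by rewrite -[leRHS]invrK invf_div lef_pV2 ?posrE// (lt_le_trans (term0 i)).
Qed.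

End FlowProcess.

Theorem theorem3p1 (R : realType) (J I : nat) (route : 'I_I -> {set 'I_J})
    (C : 'cV[R]_J) (kappa : 'cV[R]_I) (alpha : R)
    (route_nonempty : forall i, route i != finset.set0)
    (route_inj : injective route)
    (A := incidence R route)
    (rankA : \rank A = J)
    (C_gt0 : positive_vec C)
    (kappa_gt0 : positive_vec kappa)
    (alpha_ge1 : 1 <= alpha) :
  exists f : 'cV[R]_I * 'cV[R]_I -> R,
    is_load_function f /\
    forall (mu nu : 'cV[R]_I) (rho := traffic_intensity mu nu)
      (Lambda : 'cV[R]_I -> 'cV[R]_I)
      (d : measure_display) (Om : measurableType d) (P : probability Om R)
      (N : R -> Om -> 'cV[nat]_I) (T b : R),
      positive_vec mu -> positive_vec nu ->
      (forall j, (A *m rho) j 0 < C j 0) ->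
      is_fair_policy A C kappa alpha Lambda ->
      is_markov_process P (flow_rates mu nu Lambda) N ->
      {ae P, forall w, N 0 w = 0} ->
      0 <= T -> 0 < b ->
      (P [set w | (b%:E <= running_max N T w)%E] <=
        (f (mu, nu) * T /
           (gap A C rho `^ (alpha - 1) * b `^ (alpha + 1)))%:E)%E.
Proof.
have cap_gt0 (i : 'I_I) := total_capacity_gt0 route_nonempty C_gt0 i.
exists (load_constant C kappa alpha); split.
  exact: load_constant_is_load_function.
move=> mu nu rho Lambda d Om P N T b mu_gt0 nu_gt0 load_lt fair markov N0 T0 b0.
have rho_gt0 : positive_vec rho := traffic_intensity_gt0 mu_gt0 nu_gt0.
rewrite running_max_geE//.
(* Without routes no level is ever hit. Otherwise a resource on some route carries load, as [gapP]
   requires. *)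
have [noI|/existsNP[i0 _]] := pselect (forall i : 'I_I, False).
  rewrite (_ : hitting_event _ _ _ = set0); last first.
    by apply/seteqP; split => w // [t [_ [i]]]; case: (noI i).
  have [load_fun_gt0 _] := load_constant_is_load_function kappa_gt0 alpha_ge1 cap_gt0.
  rewrite measure0 lee_fin divr_ge0// ?mulr_ge0 ?powR_ge0//.
  by apply/ltW/load_fun_gt0.
have load_ge0 j : 0 <= (A *m rho) j 0.
  by rewrite mxE sumr_ge0// => i _; rewrite mulr_ge0 ?incidence_ge0 ?ltW.
have [j0 ij0] := route_resource route_nonempty i0.
have load_j0 : 0 < (A *m rho) j0 0.
  apply: lt_le_trans (rho_gt0 i0) _; rewrite [leRHS]mxE (bigD1 i0)//= [A _ _]mxE ij0 mul1r.
  by rewrite lerDl sumr_ge0// => i _; rewrite mulr_ge0 ?incidence_ge0 ?ltW.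
have [gap_gt0 gap_le] := gapP C_gt0 load_ge0 load_lt load_j0.
have alpha1_gt0 : 0 < alpha + 1 by rewrite addr_gt0// (lt_le_trans ltr01).
have coef_gt0 k := lyapunov_coef_gt0 alpha kappa_gt0 mu_gt0 nu_gt0 k.
set S := \sum_k (alpha + 1) / lyapunov_coef kappa alpha mu nu k.
have S_gt0 : 0 < S.
  rewrite /S (bigD1 i0)//=; apply: ltr_pwDl; first exact: divr_gt0.
  by apply: sumr_ge0 => k _; rewrite ltW// divr_gt0.
set B := b `^ (alpha + 1) / S.
have B_gt0 : 0 < B by rewrite divr_gt0 ?powR_gt0.
set K := drift_bound C kappa alpha rho / gap A C rho `^ (alpha - 1) / B.
have drift_ge0 : 0 <= drift_bound C kappa alpha rho by exact: drift_bound_ge0.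
have K_ge0 : 0 <= K by rewrite !divr_ge0 ?powR_ge0// ltW.
have hit := @hitting_probability_le _ _ _ P _ _ N markov
  [set n | exists i, b <= (n i 0)%:R] (@flow_neighbors I)
  (\sum_i (nu i 0 + mu i 0 * total_capacity C)) K
  (survival_bound kappa alpha mu nu B).
apply: le_trans (hit _ _ _ _ _ _ _ _ _ T 0 T0 N0) _ => //.
- move=> n m; exact: (flow_rates_ge0 route_nonempty C_gt0 mu_gt0 nu_gt0 fair).
- exact: flow_neighbors_uniq.
- exact: flow_neighbors_irr.
- exact: flow_rates_eq0.
- exact: (flow_exit_rate_le route_nonempty C_gt0 nu mu_gt0 fair).
- move=> n; exact: survival_bound01.
- move=> n [i bn]; rewrite /survival_bound max_l// subr_le0 ler_pdivlMr// mul1r.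
  exact: lyapunov_level_le bn.
- move=> n; exact: (survival_bound_drift route_nonempty C_gt0 kappa_gt0).
(* At the empty state [survival_bound] is [1], so only [K * T] remains; the summand [1] of
   [load_constant] is slack. *)
rewrite /survival_bound lyapunov0// mul0r subr0 max_r// subrr add0r lee_fin.
have -> : K * T = drift_bound C kappa alpha rho * S * T /
    (gap A C rho `^ (alpha - 1) * b `^ (alpha + 1)).
  by rewrite /K /B; field; rewrite !gt_eqF ?powR_gt0.
by rewrite ler_wpM2r ?invr_ge0 ?mulr_ge0 ?powR_ge0// ler_wpM2r// lerDl ler01.
Qed.
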